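(* Suppose the plant graph $G_{\mathcal P}$ contains no isolated node and at least one sink, the design graph $G_{\mathcal C}$ is the totally disconnected graph with self-loops (i.e. $S_{\mathcal C}=I_q$), and $G_{\mathcal K}\supseteq G_{\mathcal P}$. Then the control design method $\Gamma^{\Theta}$ (defined in the context) is undominated by any control design method $\Gamma\in\mathcal C$, i.e. no $\Gamma\in\mathcal C$ dominates $\Gamma^{\Theta}$.
   Context: Fix integers $q\ge 1$ and $n_1,\dots,n_q\ge 1$, put $n=\sum_{i=1}^q n_i$, and fix a real $\epsilon>0$. Matrices $M\in\mathbb R^{n\times n}$ are partitioned into blocks $M_{ij}\in\mathbb R^{n_i\times n_j}$, $1\le i,j\le q$. Graphs are directed with vertex set $\{1,\dots,q\}$, possibly with self-loops. The adjacency matrix $S=(s_{ij})$ of $G=(\{1,\dots,q\},E)$ is $s_{ij}=1$ if $(j,i)\in E$ and $s_{ij}=0$ otherwise. $G'\supseteq G$ means the edge set of $G'$ contains that of $G$. A vertex $i$ is a sink if there is no $j\ne i$ with $(i,j)\in E$; it is isolated if there is no $j\ne i$ with $(i,j)\in E$ or $(j,i)\in E$. Plants: given the plant graph $G_{\mathcal P}$ with adjacency matrix $S_{\mathcal P}$, let $\mathcal A(S_{\mathcal P})=\{A\in\mathbb R^{n\times n}: A_{ij}=0 \text{ whenever } (s_{\mathcal P})_{ij}=0\}$, and let $\mathcal B(\epsilon)$ be the set of diagonal $n\times n$ matrices with all diagonal entries $\ge\epsilon$. The set of plants is $\mathcal P=\mathcal A(S_{\mathcal P})\times\mathcal B(\epsilon)\times\mathbb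 R^n$; $P=(A,B,x_0)$ stands for the system $x(k+1)=Ax(k)+Bu(k)$, $x(0)=x_0$. Controllers: given the control graph $G_{\mathcal K}$ with adjacency matrix $S_{\mathcal K}$, let $\mathcal K=\{K\in\mathbb R^{n\times n}: K_{ij}=0 \text{ whenever } (s_{\mathcal K})_{ij}=0\}$; $K$ acts by $u(k)=Kx(k)$. Cost: $J_P(K)=\sum_{k=1}^\infty x(k)^Tx(k)+\sum_{k=0}^\infty u(k)^Tu(k)\in[0,\infty]$, evaluated along the closed loop of $P$ with $u=Kx$. Design methods: a control design method is a map $\Gamma:\mathcal A(S_{\mathcal P})\times\mathcal B(\epsilon)\to\mathcal K$. Given a design graph $G_{\mathcal C}$ with adjacency matrix $S_{\mathcal C}$, $\mathcal C$ is the set of control design methods $\Gamma$ with structure $G_{\mathcal C}$, meaning that for each $i$ the block row $[\Gamma_{i1}\ \cdots\ \Gamma_{iq}]$ is a function only of $\{[A_{j1}\ \cdots\ A_{jq}],\,B_{jj}: (s_{\mathcal C})_{ij}\ne 0\}$. Domination: $\Gamma$ dominates $\Gamma'$ if $J_P(\Gamma(A,B))\le J_P(\Gamma'(A,B))$ for all $P=(A,B,x_0)\in\mathcal P$, with strict inequality for at least one plant in $\mathcal P$. The method $\Gamma^{\Theta}$: let $c\ge 1$ be the number of sinks of $G_{\mathcal P}$, with vertices numbered so that the sinks are exactly $q-c+1,\dots,q$. For all $(A,B)$, $$\Gamma^{\Theta}(A,B)=-\mathrm{diag}\big(B_{11}^{-1},\dots,B_{q-c,q-c}^{-1},W_{q-c+1}(A,B),\dots,W_q(A,B)\big)A,$$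 where for $q-c+1\le i\le q$, $W_i(A,B)=(I+B_{ii}^TX_{ii}B_{ii})^{-1}B_{ii}^TX_{ii}$ and $X_{ii}$ is the unique positive definite solution of $$A_{ii}^TX_{ii}B_{ii}(I+B_{ii}^TX_{ii}B_{ii})^{-1}B_{ii}^TX_{ii}A_{ii}-A_{ii}^TX_{ii}A_{ii}+X_{ii}-I=0.$$ *)

(* Defs.v *)
From HB Require Import structures.
From mathcomp Require Import all_boot all_order all_algebra.
From mathcomp Require Import all_classical all_reals all_analysis.

Set Implicit Arguments.
Unset Strict Implicit.
Unset Printing Implicit Defensive.

Import Order.TTheory GRing.Theory Num.Theory.

Local Open Scope classical_set_scope.
Local Open Scope ring_scope.

Section Graphs.
Variable q : nat.

(* A directed graph on 'I_q, self-loops allowed: [G i j] means (i, j) \in E. *)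
Definition digraph := rel 'I_q.

(* The transposition is intended: entry (i, j) records the edge (j, i). *)
Definition adjacency (G : digraph) : 'M[int]_q :=
  \matrix_(i, j) (if G j i then 1 else 0).

Definition supergraph (G' G : digraph) : Prop := forall i j, G i j -> G' i j.

Definition sink_vertex (G : digraph) (i : 'I_q) : bool :=
  ~~ [exists j, (j != i) && G i j].

Definition isolated_vertex (G : digraph) (i : 'I_q) : bool :=
  ~~ [exists j, (j != i) && (G i j || G j i)].

End Graphs.

Section Riccati.
Variables (R : realType) (m : nat).
Implicit Types A B X : 'M[R]_m.

Definition posdefmx X : Prop :=
  X^T = X /\ forall v : 'cV[R]_m, v != 0 -> 0 < (v^T *m X *m v) 0 0.

Definition riccati_eq A B X : Prop :=
  A^T *m X *m B *m invmx (1%:M + B^T *m X *m B) *m B^T *m X *m A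
  - A^T *m X *m A + X - 1%:M = 0.

(* The positive definite solution; it exists and is unique when B is
   invertible, which is the only case in which it is used below. The default
   value 0 is returned when there is no solution. *)
Definition riccati_sol A B : 'M[R]_m :=
  xget 0 [set X | posdefmx X /\ riccati_eq A B X].

Definition riccati_gain A B : 'M[R]_m :=
  let X := riccati_sol A B in invmx (1%:M + B^T *m X *m B) *m B^T *m X.

End Riccati.

Section Control.
Variables (R : realType) (q : nat) (n_ : 'I_q -> nat).

Local Notation n := (\sum_(i < q) n_ i)%N.
Implicit Types (A B K : 'M[R]_n) (G : digraph q).

(* The matrices M such that M_ij = 0 whenever the adjacency entry s_ij is 0. *)
Definition structured_mx G : set 'M[R]_n :=
  [set M | forall i j : 'I_q, adjacency G i j = 0 -> submxblock M i j = 0].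

Definition input_mx (eps : R) : set 'M[R]_n :=
  [set B | is_diag_mx B /\ forall k : 'I_n, eps <= B k k].

Fixpoint state A B K (x0 : 'cV[R]_n) (k : nat) : 'cV[R]_n :=
  if k is k'.+1 then
    let x := state A B K x0 k' in A *m x + B *m (K *m x)
  else x0.

Definition input A B K (x0 : 'cV[R]_n) (k : nat) : 'cV[R]_n :=
  K *m state A B K x0 k.

Definition cost A B (x0 : 'cV[R]_n) K : \bar R :=
  (\sum_(1 <= k <oo)
      (((state A B K x0 k)^T *m state A B K x0 k) 0 0)%:E
   + \sum_(0 <= k <oo)
      (((input A B K x0 k)^T *m input A B K x0 k) 0 0)%:E)%E.

(* A design method is represented by a total function; only its restriction
   to structured_mx GP `*` input_mx eps matters in what follows. *)
Definition design_map := 'M[R]_n -> 'M[R]_n -> 'M[R]_n.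

(* [submxcol M i] is the i-th block row [M_i1 ... M_iq] of M. *)
Definition has_design_structure GP (eps : R) GC (Gamma : design_map) : Prop :=
  forall (i : 'I_q) A B A' B',
    structured_mx GP A -> input_mx eps B ->
    structured_mx GP A' -> input_mx eps B' ->
    (forall j : 'I_q, adjacency GC i j != 0 ->
       submxcol A j = submxcol A' j /\ submxblock B j j = submxblock B' j j) ->
    submxcol (Gamma A B) i = submxcol (Gamma A' B') i.

Definition design_methods GP (eps : R) GK GC : set design_map :=
  [set Gamma |
    (forall A B, structured_mx GP A -> input_mx eps B ->
       structured_mx GK (Gamma A B)) /\
    has_design_structure GP eps GC Gamma].

Definition dominates GP (eps : R) (Gamma Gamma' : design_map) : Prop :=
  (forall A B (x0 : 'cV[R]_n), structured_mx GP A -> input_mx eps B ->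
     (cost A B x0 (Gamma A B) <= cost A B x0 (Gamma' A B))%E) /\
  (exists A B (x0 : 'cV[R]_n), [/\ structured_mx GP A, input_mx eps B &
     (cost A B x0 (Gamma A B) < cost A B x0 (Gamma' A B))%E]).

(* Defined for an arbitrary numbering of the vertices: the i-th diagonal block
   is W_i if i is a sink of the plant graph and B_ii^-1 otherwise. *)
Definition Gamma_Theta GP : design_map := fun A B =>
  - ((\mxdiag_(i < q)
       (if sink_vertex GP i then riccati_gain (submxblock A i i) (submxblock B i i)
        else invmx (submxblock B i i))) *m A).

End Control.

(* Main.v *)
Require Import Defs.
From HB Require Import structures.
From mathcomp Require Import all_boot all_order all_algebra.
From mathcomp Require Import ring lra.
From mathcomp Require Import all_classical all_reals all_analysis.

Set Implicit Arguments.
Unset Strict Implicit.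
Unset Printing Implicit Defensive.

Import Order.TTheory GRing.Theory Num.Theory.
Import numFieldNormedType.Exports.
Local Open Scope classical_set_scope.
Local Open Scope ring_scope.

(* The cost of Gamma_Theta splits over the blocks. Writing z = A x0, a non-sink
   block is driven to 0 in one step at the price |B_ii^-1 z_i|^2, and a sink
   block, which influences no other block, pays the LQR value of (A_ii, B_ii)
   started with drift z_i. Let Gamma have block rows depending only on the
   matching block rows of A and B, and never be worse than Gamma_Theta.

   If i is not a sink, it feeds some j <> i. Were x_i(1) nonzero under Gamma,
   replace the rows of A in block j by a single entry r reading the nonzero
   coordinate of x_i; this does not change x_i(1). For B_jj large, regulating
   j at steps 1 and 2 costs Gamma more, to order r^2, than the deadbeat input
   costs at step 0; letting r grow is a contradiction. So Gamma is deadbeat on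
   the non-sinks, its cost there is that of Gamma_Theta, and on each sink its
   cost is at least the LQR value. Hence strict improvement is impossible.

   A positive definite Riccati solution exists because value iteration from 0
   is monotone and bounded by the cost of the deadbeat input. *)

(** * Squared norms and quadratic forms *)

Section QuadraticForms.
Variable R : realType.

Definition sqnorm m (v : 'cV[R]_m) : R := (v^T *m v) 0 0.
Definition qform m (M : 'M[R]_m) (v : 'cV[R]_m) : R := (v^T *m M *m v) 0 0.

Lemma sqnormE m (v : 'cV[R]_m) : sqnorm v = \sum_i v i 0 ^+ 2.
Proof.
by rewrite /sqnorm mxE; apply: eq_bigr => i _; rewrite mxE expr2.
Qed.

Lemma sqnorm_ge0 m (v : 'cV[R]_m) : 0 <= sqnorm v.
Proof. by rewrite sqnormE sumr_ge0 // => i _; rewrite sqr_ge0. Qed.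

Lemma sqnorm_gt0 m (v : 'cV[R]_m) : v != 0 -> 0 < sqnorm v.
Proof.
move=> v0; rewrite lt_neqAle sqnorm_ge0 andbT eq_sym; apply: contra v0.
rewrite sqnormE psumr_eq0 => [/allP v0|i _]; last exact: sqr_ge0.
apply/eqP/matrixP => i j; rewrite ord1 mxE; apply/eqP.
by have := v0 i (mem_index_enum _); rewrite sqrf_eq0.
Qed.

Lemma sqnorm0 m : sqnorm (0 : 'cV[R]_m) = 0.
Proof. by rewrite /sqnorm mulmx0 mxE. Qed.

Lemma sqnormN m (v : 'cV[R]_m) : sqnorm (- v) = sqnorm v.
Proof. by rewrite !sqnormE; apply: eq_bigr => i _; rewrite mxE sqrrN. Qed.

Lemma entry_le_sqnorm m (v : 'cV[R]_m) i : v i 0 ^+ 2 <= sqnorm v.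
Proof.
rewrite sqnormE (bigD1 i) //= lerDl sumr_ge0 // => j _; exact: sqr_ge0.
Qed.

Lemma sqnorm_mxcol q (n_ : 'I_q -> nat) (v : 'cV[R]_(\sum_i n_ i)%N) :
  sqnorm v = \sum_i sqnorm (submxcol v i).
Proof.
by rewrite /sqnorm -[v in LHS]submxcolK tr_mxcol mul_mxrow_mxcol summxE.
Qed.

Lemma qform1 m (v : 'cV[R]_m) : qform 1%:M v = sqnorm v.
Proof. by rewrite /qform mulmx1. Qed.

Lemma qform0 m (v : 'cV[R]_m) : qform 0 v = 0.
Proof. by rewrite /qform mulmx0 mul0mx mxE. Qed.

Lemma qformv0 m (M : 'M[R]_m) : qform M 0 = 0.
Proof. by rewrite /qform mulmx0 mxE. Qed.

Lemma qformDl m (M N : 'M[R]_m) v : qform (M + N) v = qform M v + qform N v.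
Proof. by rewrite /qform mulmxDr mulmxDl mxE. Qed.

Lemma qformBl m (M N : 'M[R]_m) v : qform (M - N) v = qform M v - qform N v.
Proof. by rewrite /qform mulmxBr mulmxBl !mxE. Qed.

Lemma qformM m p (M : 'M[R]_m) (N : 'M[R]_(m, p)) v :
  qform M (N *m v) = qform (N^T *m M *m N) v.
Proof. by rewrite /qform trmx_mul !mulmxA. Qed.

Lemma qformD m (M : 'M[R]_m) u v : M^T = M ->
  qform M (u + v) = qform M u + (u^T *m M *m v) 0 0 *+ 2 + qform M v.
Proof.
move=> sM; have addE (a b : 'M[R]_1) : (a + b) 0 0 = a 0 0 + b 0 0.
  by rewrite mxE.
rewrite /qform [(_ + _)^T]linearD /= !mulmxDl !mulmxDr !addE.
have -> : (v^T *m M *m u) 0 0 = (u^T *m M *m v) 0 0.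
  rewrite -[in LHS](trmxK (v^T *m M *m u)) [LHS]mxE.
  by rewrite !trmx_mul trmxK sM mulmxA.
by ring.
Qed.

Lemma qform_delta m (M : 'M[R]_m) i : qform M (delta_mx i 0) = M i i.
Proof. by rewrite /qform trmx_delta -rowE -colE !mxE. Qed.

(** Polarisation: it turns convergence of the quadratic forms into convergence of the entries. *)
Lemma sym_entryE m (M : 'M[R]_m) i j : M^T = M ->
  M i j = (qform M (delta_mx i 0 + delta_mx j 0) - M i i - M j j) / 2.
Proof.
move=> sM; rewrite qformD // !qform_delta trmx_delta -rowE -colE !mxE.
by field.
Qed.

Lemma qform_le_sqnorm m (M : 'M[R]_m) :
  exists2 c, 0 <= c & forall v, qform M v <= c * sqnorm v.
Proof.
(* The sum of the absolute values of all entries works, because |v_i v_j| <= |v|^2. *)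
exists (\sum_i \sum_j `|M j i|) => [|v].
  by rewrite sumr_ge0 // => i _; rewrite sumr_ge0.
rewrite /qform mxE mulr_suml ler_sum // => i _.
rewrite mxE !mulr_suml ler_sum // => j _; rewrite mxE.
have [vi vj] := (entry_le_sqnorm v i, entry_le_sqnorm v j).
apply: le_trans (ler_norm _) _; rewrite !normrM mulrAC mulrC mulrA.
rewrite -mulrA ler_wpM2l // -normrM ler_norml.
by apply/andP; split; nra.
Qed.

End QuadraticForms.

(** * One-step linear-quadratic minimisation *)

Section LQR.
Variables (R : realType) (m : nat).
Implicit Types A B X Q : 'M[R]_m.

Definition psdmx X : Prop := X^T = X /\ forall v, 0 <= qform X v.

Lemma posdef_psd X : posdefmx X -> psdmx X.
Proof.
move=> [sX pX]; split=> // v; have [->|/pX/ltW//] := eqVneq v 0.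
by rewrite qformv0.
Qed.

Lemma posdef_unitmx X : posdefmx X -> X \in unitmx.
Proof.
move=> [sX pX]; rewrite -row_free_unit; apply: inj_row_free => v vX0.
apply/eqP; apply: contraT => v0; have := pX v^T.
rewrite trmxK vX0 mul0mx mxE ltxx; apply.
by apply: contra v0 => /eqP/(congr1 trmx); rewrite trmxK linear0 => ->.
Qed.

(** For symmetric X, half the Hessian in u of |u|^2 + qform X (z + B u). At [riccati_sol],
    [lqr_gain] is [riccati_gain]. *)
Definition lqr_mx B X := 1%:M + B^T *m X *m B.
Definition lqr_gain B X := invmx (lqr_mx B X) *m B^T *m X.
(* [qform (lqr_next B X) z] is the minimum over u of
   |u|^2 + qform X (z + B u); the minimiser is u = - lqr_gain B X z. *)
Definition lqr_next B X := X - X *m B *m lqr_gain B X.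

Lemma lqr_mx_posdef B X : psdmx X -> posdefmx (lqr_mx B X).
Proof.
move=> [sX pX]; split=> [|v v0].
  by rewrite /lqr_mx [(_ + _)^T]linearD /= trmx1 !trmx_mul trmxK sX mulmxA.
rewrite -/(qform _ _) qformDl qform1 -qformM.
by rewrite ltr_pwDl ?sqnorm_gt0.
Qed.

Lemma lqr_mx_unit B X : psdmx X -> lqr_mx B X \in unitmx.
Proof. by move=> /lqr_mx_posdef pX; apply: posdef_unitmx. Qed.

Lemma mul_lqr_gain B X : psdmx X -> lqr_mx B X *m lqr_gain B X = B^T *m X.
Proof. by move=> pX; rewrite /lqr_gain -mulmxA mulKVmx ?lqr_mx_unit. Qed.

Lemma tr_lqr_gain B X : psdmx X -> (lqr_gain B X)^T *m lqr_mx B X = X *m B.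
Proof.
move=> pX; have [sL _] := lqr_mx_posdef B pX.
rewrite -[in LHS]sL -trmx_mul mul_lqr_gain // trmx_mul trmxK.
by case: pX => ->.
Qed.

Lemma lqr_next_sym B X : psdmx X -> (lqr_next B X)^T = lqr_next B X.
Proof.
(* With W the gain and L = [lqr_mx B X], X B becomes W^T L, so the subtracted term is the visibly
   symmetric W^T L W. *)
move=> pX; have [sX _] := pX; rewrite /lqr_next -(tr_lqr_gain B pX).
have [sL _] := lqr_mx_posdef B pX.
move: (lqr_gain B X) => W.
by rewrite [(_ - _)^T]linearB /= !trmx_mul trmxK sL sX mulmxA.
Qed.

(** Completion of the square in u; the last term is the price of deviating from the optimal
    input. *)
Lemma lqr_square B X z u : psdmx X ->
  sqnorm u + qform X (z + B *m u) =
  qform (lqr_next B X) z + qform (lqr_mx B X) (u + lqr_gain B X *m z).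
Proof.
move=> pX; have [sX _] := pX; have [sL _] := lqr_mx_posdef B pX.
have := mul_lqr_gain B pX; have := tr_lqr_gain B pX.
rewrite /lqr_next; move: (lqr_gain B X) => W WL LW.
rewrite addrC (addrC z) !qformD // !qformM qformBl.
rewrite -WL qformDl qform1 !mulmxA.
rewrite -(mulmxA u^T) LW trmx_mul !mulmxA.
rewrite -qformM.
by ring.
Qed.

Lemma lqr_next_le B X z u : psdmx X ->
  qform (lqr_next B X) z <= sqnorm u + qform X (z + B *m u).
Proof.
by move=> pX; rewrite lqr_square // lerDl;
  case: (posdef_psd (lqr_mx_posdef B pX)).
Qed.

Lemma lqr_next_eq B X z : psdmx X ->
  qform (lqr_next B X) z = sqnorm (- (lqr_gain B X *m z))
    + qform X (z + B *m - (lqr_gain B X *m z)).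
Proof. by move=> pX; rewrite lqr_square // addNr qformv0 addr0. Qed.

Lemma lqr_next_psd B X : psdmx X -> psdmx (lqr_next B X).
Proof.
move=> pX; split=> [|v]; first exact: lqr_next_sym.
by rewrite lqr_next_eq // addr_ge0 ?sqnorm_ge0 //; case: pX.
Qed.

(** The minimiser for Y is a competitor for X. *)
Lemma lqr_next_mono B X Y z : psdmx X -> psdmx Y ->
  (forall v, qform X v <= qform Y v) ->
  qform (lqr_next B X) z <= qform (lqr_next B Y) z.
Proof.
move=> pX pY XY; rewrite (lqr_next_eq B _ pY).
apply: le_trans (lqr_next_le B z (- (lqr_gain B Y *m z)) pX) _.
by rewrite lerD2l XY.
Qed.

(** The competitor is the deadbeat input - B^-1 z, which leaves no residual state. *)
Lemma lqr_next_bound B X z : B \in unitmx -> psdmx X ->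
  qform (lqr_next B X) z <= sqnorm (invmx B *m z).
Proof.
move=> uB pX; apply: le_trans (lqr_next_le B z (- (invmx B *m z)) pX) _.
by rewrite sqnormN mulmxN mulKVmx // subrr qformv0 addr0.
Qed.

(** An inverse-free characterisation of [lqr_next]: it passes to limits through sums and products
    alone. *)
Lemma lqr_next_mulr B X : psdmx X ->
  lqr_next B X *m (1%:M + B *m B^T *m X) = X.
Proof.
move=> pX; rewrite mulmxBl -(mulmxA (X *m B)).
suff -> : lqr_gain B X *m (1%:M + B *m B^T *m X) = B^T *m X.
  by rewrite mulmxDr mulmx1 !mulmxA addrK.
rewrite /lqr_gain -!mulmxA.
have -> : B^T *m (X *m (1%:M + B *m (B^T *m X))) = lqr_mx B X *m (B^T *m X).
  by rewrite !mulmxDr mulmx1 mulmxDl mul1mx !mulmxA.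
by rewrite mulKmx ?lqr_mx_unit.
Qed.


(** An explicit right inverse of the factor in [lqr_next_mulr], so that this factor can be
    cancelled. *)
Lemma lqr_next_invr B X : psdmx X ->
  (1%:M + B *m B^T *m X) *m (1%:M - B *m lqr_gain B X) = 1%:M.
Proof.
move=> pX; have E : lqr_gain B X + B^T *m X *m B *m lqr_gain B X = B^T *m X.
  by rewrite -[RHS]mul_lqr_gain // mulmxDl mul1mx.
rewrite mulmxBr mulmx1 mulmxDl mul1mx; move: (lqr_gain B X) E => W E.
rewrite -[B *m B^T *m X]mulmxA -[B *m _ *m (B *m W)]mulmxA -mulmxDr.
by rewrite (mulmxA (B^T *m X)) E addrK.
Qed.

End LQR.

(** * Existence of a positive definite Riccati solution by value iteration *)

Section RiccatiExistence.
Variable R : realType.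

Definition mxcvg m p (M : nat -> 'M[R]_(m, p)) (L : 'M[R]_(m, p)) : Prop :=
  forall i j, (fun k => M k i j) @ \oo --> L i j.

Lemma mxcvg_cst m p (L : 'M[R]_(m, p)) : mxcvg (fun=> L) L.
Proof. by move=> i j; exact: cvg_cst. Qed.

Lemma mxcvgD m p (M N : nat -> 'M[R]_(m, p)) L K :
  mxcvg M L -> mxcvg N K -> mxcvg (fun k => M k + N k) (L + K).
Proof.
move=> cM cN i j; rewrite mxE.
under eq_fun do rewrite mxE; exact: cvgD.
Qed.

Lemma mxcvgM m p r (M : nat -> 'M[R]_(m, p)) (N : nat -> 'M[R]_(p, r)) L K :
  mxcvg M L -> mxcvg N K -> mxcvg (fun k => M k *m N k) (L *m K).
Proof.
move=> cM cN i j; rewrite mxE.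
under eq_fun do rewrite mxE.
apply: cvg_big => [|l _]; [exact: add_continuous|exact: cvgM].
Qed.

Lemma mxcvg_unique m p (M : nat -> 'M[R]_(m, p)) L K :
  mxcvg M L -> mxcvg M K -> L = K.
Proof.
by move=> cL cK; apply/matrixP => i j; apply: cvg_unique (cL i j) (cK i j).
Qed.

Lemma mxcvg_shift m p (M : nat -> 'M[R]_(m, p)) L :
  mxcvg M L -> mxcvg (fun k => M k.+1) L.
Proof. by move=> cM i j; have := cM i j; rewrite -cvg_shiftS. Qed.

Lemma mxcvg_qform m (M : nat -> 'M[R]_m) L v : mxcvg M L ->
  (fun k => qform (M k) v) @ \oo --> qform L v.
Proof.
move=> cM; have := mxcvgM (mxcvgM (@mxcvg_cst _ _ v^T) cM) (@mxcvg_cst _ _ v).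
by move=> /(_ 0 0).
Qed.

(** Each quadratic form is a bounded nondecreasing real sequence; by polarisation the entries
    converge too. *)
Lemma mxcvg_monotone m (Q : nat -> 'M[R]_m) (b : 'cV[R]_m -> R) :
  (forall k, (Q k)^T = Q k) ->
  (forall k v, qform (Q k) v <= qform (Q k.+1) v) ->
  (forall k v, qform (Q k) v <= b v) ->
  exists L, mxcvg Q L.
Proof.
move=> sQ monoQ Qb.
have cq v : cvgn (fun k => qform (Q k) v).
  apply: nondecreasing_is_cvgn; first by apply/nondecreasing_seqP.
  by exists (b v) => _ [k _ <-].
have cQ i j : cvgn (fun k => Q k i j).
  under eq_fun => k do rewrite sym_entryE // -!qform_delta.
  apply: is_cvgM; last exact: is_cvg_cst.
  by apply: is_cvgB; [apply: is_cvgB|]; exact: cq.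
exists (\matrix_(i, j) lim ((fun k => Q k i j) @ \oo)) => i j.
by rewrite mxE; exact: cQ.
Qed.

Variable m : nat.
Implicit Types A B X Q : 'M[R]_m.

(** Q values the drift A x, not the state x; the stage cost is the resulting value of x, including
    |x|^2. *)
Definition stage_cost A Q : 'M[R]_m := 1%:M + A^T *m Q *m A.

(** [stage_cost A Q] is literally [lqr_mx A Q]. *)
Lemma stage_cost_posdef A Q : psdmx Q -> posdefmx (stage_cost A Q).
Proof. exact: lqr_mx_posdef. Qed.

Fixpoint value_iter A B k : 'M[R]_m :=
  if k is k'.+1 then lqr_next B (stage_cost A (value_iter A B k')) else 0.

Lemma value_iter_psd A B k : psdmx (value_iter A B k).
Proof.
elim: k => [|k IH] /=; last first.
  by apply: lqr_next_psd; apply: posdef_psd; apply: stage_cost_posdef.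
by split=> [|v]; rewrite ?linear0 ?qform0.
Qed.

Lemma stage_cost_iter_psd A B k : psdmx (stage_cost A (value_iter A B k)).
Proof.
by apply: posdef_psd; apply: stage_cost_posdef; exact: value_iter_psd.
Qed.

Lemma value_iter_mono A B k v :
  qform (value_iter A B k) v <= qform (value_iter A B k.+1) v.
Proof.
elim: k v => [|k IH] v.
  by rewrite [value_iter A B 0]/= qform0; case: (value_iter_psd A B 1).
apply: lqr_next_mono (stage_cost_iter_psd A B k)
  (stage_cost_iter_psd A B k.+1) _.
by move=> w; rewrite /stage_cost !qformDl -!qformM lerD2l IH.
Qed.

Lemma riccati_exists A B : B \in unitmx ->
  exists X, posdefmx X /\ riccati_eq A B X.
Proof.
move=> uB; pose Q := value_iter A B.
have [L QL] : exists L, mxcvg Q L.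
  apply: (@mxcvg_monotone _ _ (fun z => sqnorm (invmx B *m z))).
  - by move=> k; case: (value_iter_psd A B k).
  - exact: value_iter_mono.
  - case=> [|k] v; first by rewrite /= qform0 sqnorm_ge0.
    by apply: lqr_next_bound => //; exact: stage_cost_iter_psd.
have pL : psdmx L.
  split=> [|v].
    apply/matrixP => i j; rewrite mxE; apply: cvg_unique (QL j i) _ => //.
    suff -> : (fun k => Q k j i) = (fun k => Q k i j) by exact: QL.
    apply/funext => k; have [sQ _] := value_iter_psd A B k.
    by rewrite /Q -[in LHS]sQ mxE.
  apply: (cvgr_to_ge (mxcvg_qform QL)); apply: nearW => k.
  by case: (value_iter_psd A B k).
(* The limit L values drifts; the Riccati solution values states, and the identity summand makes it
   positive definite. *)
pose X := stage_cost A L.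
have pX : posdefmx X by apply: stage_cost_posdef.
have XL : mxcvg (fun k => stage_cost A (Q k)) X.
  apply: mxcvgD; first exact: mxcvg_cst.
  apply: mxcvgM; last exact: mxcvg_cst.
  by apply: mxcvgM; first exact: mxcvg_cst.
have LX : L *m (1%:M + B *m B^T *m X) = X.
  apply: mxcvg_unique (XL).
  have -> : (fun k => stage_cost A (Q k)) = fun k =>
      Q k.+1 *m (1%:M + B *m B^T *m stage_cost A (Q k)).
    apply/funext => k; rewrite /Q /= lqr_next_mulr //.
    exact: stage_cost_iter_psd.
  apply: mxcvgM (mxcvg_shift QL) _; apply: mxcvgD (@mxcvg_cst _ _ 1%:M) _.
  exact: mxcvgM (@mxcvg_cst _ _ (B *m B^T)) XL.
(* Both sides give X when multiplied by 1 + B B^T X, which has a right inverse. *)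
have qX : lqr_next B X = L.
  by rewrite -[LHS]mulmx1 -[RHS]mulmx1 -(lqr_next_invr B (posdef_psd pX))
    !mulmxA lqr_next_mulr ?LX //; exact: posdef_psd.
exists X; split=> //; rewrite /riccati_eq.
have EX : A^T *m L *m A = X - 1%:M by rewrite /X /stage_cost addrC addKr.
move: EX; rewrite -qX /lqr_next mulmxBr mulmxBl /lqr_gain /lqr_mx !mulmxA => EX.
by rewrite -addrA -EX addrC addrA subrK subrr.
Qed.

End RiccatiExistence.

(** * Riccati solutions along trajectories *)

Section Trajectories.
Variables (R : realType) (m : nat).
Implicit Types A B X Q : 'M[R]_m.

Lemma riccati_stage_cost A B X : riccati_eq A B X ->
  stage_cost A (lqr_next B X) = X.
Proof.
rewrite /riccati_eq /stage_cost /lqr_next mulmxBr mulmxBl /lqr_gain /lqr_mx.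
rewrite !mulmxA; set S := _ *m A; set T := A^T *m X *m A => /eqP.
rewrite subr_eq0 => /eqP <-.
by rewrite -(opprB S T) addrAC subrr add0r.
Qed.

Lemma riccati_solP A B : B \in unitmx ->
  posdefmx (riccati_sol A B) /\
  stage_cost A (lqr_next B (riccati_sol A B)) = riccati_sol A B.
Proof.
move=> uB; have /xgetPex : exists X, [set X | posdefmx X /\ riccati_eq A B X] X.
  by have [X ?] := riccati_exists A uB; exists X.
by move=> /(_ 0) [? /riccati_stage_cost].
Qed.

(** Summing [lqr_square] along the trajectory telescopes by the fixed-point equation. The initial
    drift [z 0] is free, so it may include the influence of other blocks. *)
Lemma lqr_telescope A B X (x u z : nat -> 'cV[R]_m) N :
  posdefmx X -> stage_cost A (lqr_next B X) = X ->
  (forall k, x k.+1 = z k + B *m u k) ->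
  (forall k, z k.+1 = A *m x k.+1) ->
  \sum_(k < N.+1) sqnorm (u k) + \sum_(k < N) sqnorm (x k.+1)
    + qform X (x N.+1) =
  qform (lqr_next B X) (z 0%N)
    + \sum_(k < N.+1) qform (lqr_mx B X) (u k + lqr_gain B X *m z k).
Proof.
move=> /posdef_psd pX EX xS zS; elim: N => [|N IH].
  by rewrite !big_ord_recr !big_ord0 /= !add0r addr0 xS lqr_square.
rewrite big_ord_recr [\sum_(k < N.+1) sqnorm (x _)]big_ord_recr /=.
rewrite [in RHS]big_ord_recr /=; move: IH.
have := lqr_square B (z N.+1) (u N.+1) pX; rewrite -xS.
have : qform X (x N.+1) =
    sqnorm (x N.+1) + qform (lqr_next B X) (z N.+1).
  by rewrite -[X in LHS]EX qformDl qform1 -qformM -zS.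
lra.
Qed.

End Trajectories.

(** * Truncated costs and the infinite-horizon cost *)

Section Cost.
Variables (R : realType) (q : nat) (n_ : 'I_q -> nat).
Local Notation n := (\sum_(i < q) n_ i)%N.
Implicit Types A B K : 'M[R]_n.

(** Inputs 0 to N but states 1 to N only: the state N+1 produced by the last input is left to a
    terminal term. *)
Definition pcost A B (x0 : 'cV[R]_n) K N : R :=
  \sum_(k < N.+1) sqnorm (input A B K x0 k)
  + \sum_(k < N) sqnorm (state A B K x0 k.+1).

Lemma pcost_le_cost A B x0 K N : ((pcost A B x0 K N)%:E <= cost A B x0 K)%E.
Proof.
rewrite /pcost EFinD addeC leeD //.
  have := @nneseries_lim_ge R
    (fun k => (sqnorm (state A B K x0 k))%:E) xpredT 1 N.+1.
  rewrite sumEFin big_add1 /= big_mkord; apply=> k _ _.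
  by rewrite lee_fin sqnorm_ge0.
have := @nneseries_lim_ge R
  (fun k => (sqnorm (input A B K x0 k))%:E) xpredT 0 N.+1.
rewrite sumEFin big_mkord; apply=> k _ _.
by rewrite lee_fin sqnorm_ge0.
Qed.

Lemma cost_le A B x0 K V : (forall N, pcost A B x0 K N <= V) ->
  (cost A B x0 K <= V%:E)%E.
Proof.
move=> leV.
have s0 k : (0 <= (sqnorm (state A B K x0 k))%:E)%E.
  by rewrite lee_fin sqnorm_ge0.
have i0 k : (0 <= (sqnorm (input A B K x0 k))%:E)%E.
  by rewrite lee_fin sqnorm_ge0.
have cs := @is_cvg_nneseries R _ xpredT 1 (fun k _ _ => s0 k).
have ci := @is_cvg_nneseries R _ xpredT 0 (fun k _ _ => i0 k).
have ds := ge0_adde_def (@nneseries_ge0 R _ xpredT 1 (fun k _ _ => s0 k))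
  (@nneseries_ge0 R _ xpredT 0 (fun k _ _ => i0 k)).
rewrite /cost -(limeD cs ci ds); apply: lime_le.
  exact: is_cvgeD ds cs ci.
(* Cutting both series below N+1 gives exactly [pcost] at N; the empty cut at 0 is skipped. *)
exists 1%N => // -[//|N] _ /=.
rewrite !sumEFin -EFinD lee_fin big_add1 /= !big_mkord addrC.
exact: leV.
Qed.

End Cost.

(** * Block structure of plants and inputs *)

Section BlockDynamics.
Variables (R : realType) (q : nat) (n_ : 'I_q -> nat).
Local Notation n := (\sum_(i < q) n_ i)%N.
Implicit Types A B K : 'M[R]_n.
Implicit Type v : 'cV[R]_n.

Lemma diag_mul_entry m (D : 'M[R]_m) (w : 'cV[R]_m) s :
  is_diag_mx D -> (D *m w) s 0 = D s s * w s 0.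
Proof.
move=> /is_diag_mxP dD; rewrite mxE (bigD1 s) //= big1 ?addr0 // => j js.
by rewrite dD ?mul0r // eq_sym.
Qed.

Lemma diag_unitmx m (D : 'M[R]_m) :
  is_diag_mx D -> (forall k, 0 < D k k) -> D \in unitmx.
Proof.
move=> dD pD; rewrite unitmxE det_trig ?is_diag_mx_is_trig // unitfE.
by apply/prodf_neq0 => k _; rewrite gt_eqF.
Qed.

Lemma submxcol_mulmx A v i :
  submxcol (A *m v) i = \sum_j submxblock A i j *m submxcol v j.
Proof.
rewrite -submxcol_mul -{1}[submxcol A i]submxrowK -{1}[v]submxcolK.
by rewrite mul_mxrow_mxcol; apply: eq_bigr => j _; rewrite submxblockEv.
Qed.

Variable eps : R.
Hypothesis eps_gt0 : 0 < eps.

Lemma input_mx_unit B : input_mx eps B -> B \in unitmx.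
Proof.
by move=> [dB eB]; apply: diag_unitmx => // k; apply: lt_le_trans (eB k).
Qed.

Lemma input_mx_block B i :
  input_mx eps B -> submxblock B i i \in unitmx.
Proof.
move=> [dB eB]; move: (dB).
rewrite -{1}[B]submxblockK => /is_diag_mxblockP[_ dBi].
apply: diag_unitmx; first exact: dBi.
by move=> k; rewrite !mxE; apply: lt_le_trans (eB _).
Qed.

Lemma submxcol_input B v i : input_mx eps B ->
  submxcol (B *m v) i = submxblock B i i *m submxcol v i.
Proof.
move=> [+ _]; rewrite -{1}[B]submxblockK => /is_diag_mxblockP[B0 _].
rewrite submxcol_mulmx (bigD1 i) //= big1 ?addr0 // => j ji.
by rewrite B0 ?mul0mx // eq_sym.
Qed.

Lemma submxcol_invmx B v i : input_mx eps B ->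
  submxcol (invmx B *m v) i = invmx (submxblock B i i) *m submxcol v i.
Proof.
move=> iB; have uB := input_mx_unit iB.
rewrite -[v in RHS](mulKVmx uB) (submxcol_input _ _ iB).
by rewrite mulKmx // input_mx_block.
Qed.

Variable GP : digraph q.

(** * Closed loops that are deadbeat on the non-sinks *)

Section DeadbeatNonsinks.
Variables (A B K : 'M[R]_n) (x0 : 'cV[R]_n).
Hypothesis stA : structured_mx GP A.
Hypothesis inB : input_mx eps B.
Hypothesis dead : forall i, ~~ sink_vertex GP i ->
  forall k, submxcol (state A B K x0 k.+1) i = 0.

Let x k := state A B K x0 k.
Let u k := input A B K x0 k.
Let z k := A *m x k.

Let xS i k : submxcol (x k.+1) i =
  submxcol (z k) i + submxblock B i i *m submxcol (u k) i.
Proof. by rewrite -submxcol_input // -submxcolD. Qed.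

(** From step 1 on, the other non-sinks are at 0, and sinks have no edge to another block. *)
Lemma deadbeat_drift i k :
  submxcol (z k.+1) i = submxblock A i i *m submxcol (x k.+1) i.
Proof.
rewrite /z submxcol_mulmx (bigD1 i) //= big1 ?addr0 // => j ji.
have [sj|nsj] := boolP (sink_vertex GP j); last by rewrite /x dead // mulmx0.
rewrite stA ?mul0mx // mxE; case: ifP => // Gji.
by move: sj => /existsPn/(_ i); rewrite eq_sym ji Gji.
Qed.

(** A function of the drift (A x0)_i, which contains what all blocks send to i at step 0. *)
Definition block_value (i : 'I_q) : R :=
  if sink_vertex GP i then
    qform (lqr_next (submxblock B i i)
             (riccati_sol (submxblock A i i) (submxblock B i i)))
      (submxcol (A *m x0) i)
  else sqnorm (invmx (submxblock B i i) *m submxcol (A *m x0) i).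

Let bcost i N := \sum_(k < N.+1) sqnorm (submxcol (u k) i)
  + \sum_(k < N) sqnorm (submxcol (x k.+1) i).

Let pcost_blocks N : pcost A B x0 K N = \sum_i bcost i N.
Proof.
rewrite /pcost big_split /= [in RHS]exchange_big /=.
rewrite [\sum_i \sum_(k < N) _]exchange_big /=.
by congr (_ + _); apply: eq_bigr => k _; rewrite sqnorm_mxcol.
Qed.

Let nonsink_bcost i N : ~~ sink_vertex GP i -> bcost i N = block_value i.
Proof.
move=> nsi; rewrite /block_value (negbTE nsi) /bcost.
have uB := input_mx_block i inB.
(* Reaching 0 forces the input - B_ii^-1 z_i; after step 0 the drift, hence the input, vanishes. *)
have ui k : submxcol (u k) i = - (invmx (submxblock B i i) *m submxcol (z k) i).
  have := xS i k; rewrite [x _]/x dead // => /eqP.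
  rewrite eq_sym addrC addr_eq0 => /eqP.
  move=> /(congr1 (mulmx (invmx (submxblock B i i)))).
  by rewrite mulKmx // mulmxN.
rewrite big_ord_recl ui sqnormN /= !big1 ?addr0 //= => k _.
  by rewrite /x dead // sqnorm0.
by rewrite /bump /= add1n ui deadbeat_drift /x dead // !mulmx0 oppr0 sqnorm0.
Qed.

Let sink_bcost i N : sink_vertex GP i ->
  let X := riccati_sol (submxblock A i i) (submxblock B i i) in
  bcost i N + qform X (submxcol (x N.+1) i) = block_value i
  + \sum_(k < N.+1) qform (lqr_mx (submxblock B i i) X)
      (submxcol (u k) i + lqr_gain (submxblock B i i) X *m submxcol (z k) i).
Proof.
move=> si X; rewrite /block_value si.
have [pX EX] := riccati_solP (submxblock A i i) (input_mx_block i inB).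
exact: (@lqr_telescope _ _ _ _ _ (fun k => submxcol (x k) i)
  (fun k => submxcol (u k) i) (fun k => submxcol (z k) i) N pX EX
  (xS i) (deadbeat_drift i)).
Qed.

(** The slack terms of [sink_bcost] are nonnegative, and its terminal term is bounded by a multiple
    of |x(N+1)|^2 with a constant independent of N. *)
Lemma value_le_pcost : exists2 c, 0 <= c &
  forall N, \sum_i block_value i <= pcost A B x0 K N + c * sqnorm (x N.+1).
Proof.
pose X i := riccati_sol (submxblock A i i) (submxblock B i i).
have /choice[c cP] i : exists c, 0 <= c /\
    forall w : 'cV_(n_ i), qform (X i) w <= c * sqnorm w.
  by have [c ? ?] := qform_le_sqnorm (X i); exists c.
exists (\sum_i c i) => [|N]; first by apply: sumr_ge0 => i _; case: (cP i).
rewrite pcost_blocks mulr_suml -big_split /= ler_sum // => i _.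
have [c0 cX] := cP i.
have cx : c i * sqnorm (submxcol (x N.+1) i) <= c i * sqnorm (x N.+1).
  apply: ler_wpM2l => //; rewrite [leRHS]sqnorm_mxcol (bigD1 i) //= lerDl.
  by apply: sumr_ge0 => j _; exact: sqnorm_ge0.
have [si|nsi] := boolP (sink_vertex GP i); last first.
  by rewrite nonsink_bcost // lerDl mulr_ge0 ?sqnorm_ge0.
have := sink_bcost N si => /= E.
have [pX _] := riccati_solP (submxblock A i i) (input_mx_block i inB).
have : 0 <= \sum_(k < N.+1) qform (lqr_mx (submxblock B i i) (X i))
    (submxcol (u k) i + lqr_gain (submxblock B i i) (X i) *m submxcol (z k) i).
  apply: sumr_ge0 => k _.
  by case: (posdef_psd (lqr_mx_posdef (submxblock B i i) (posdef_psd pX))).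
have := cX (submxcol (x N.+1) i); rewrite /X; lra.
Qed.

(** If the cost C were below the value V, every c |x(N+1)|^2 would be at least V - C > 0, although
    the |x(k)|^2 sum to at most C. *)
Lemma value_le_cost : ((\sum_i block_value i)%:E <= cost A B x0 K)%E.
Proof.
have [c c0 Vc] := value_le_pcost.
set V := \sum_i _ in Vc *; rewrite leNgt; apply/negP => ltV.
have cost0 : (0 <= cost A B x0 K)%E.
  apply: le_trans (pcost_le_cost A B x0 K 0); rewrite lee_fin.
  by apply: addr_ge0; apply: sumr_ge0 => k _; exact: sqnorm_ge0.
have fc : cost A B x0 K \is a fin_num.
  by rewrite ge0_fin_numE // (lt_trans ltV) ?ltry.
move: ltV; rewrite -(fineK fc) lte_fin; set C := fine _ => CV.
have pC N : pcost A B x0 K N <= C.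
  by rewrite -lee_fin (fineK fc) pcost_le_cost.
have xge N : V - C <= c * sqnorm (x N.+1).
  by have := Vc N; have := pC N; lra.
have sumx N : \sum_(k < N) sqnorm (x k.+1) <= C.
  apply: le_trans (pC N); rewrite /pcost lerDr.
  by apply: sumr_ge0 => k _; exact: sqnorm_ge0.
have bnd N : N%:R * (V - C) <= c * C.
  apply: le_trans (ler_wpM2l c0 (sumx N)).
  rewrite mulr_sumr.
  have -> : N%:R * (V - C) = \sum_(k < N) (V - C).
    by rewrite sumr_const card_ord mulr_natl.
  by apply: ler_sum => k _; exact: xge.
have VC : 0 < V - C by rewrite subr_gt0.
(* An integer N above c C / (V - C) violates [bnd]. *)
have := bnd (Num.bound (c * C / (V - C))).
rewrite leNgt => /negP; apply.
rewrite -ltr_pdivrMr //; apply: archi_boundP.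
have C0 : 0 <= C by have := sumx 0%N; rewrite big_ord0.
by rewrite divr_ge0 ?mulr_ge0 // ltW.
Qed.

(* Only the sinks can contribute the slack terms of [sink_bcost], and on them
   the input is exactly the minimiser. *)
Lemma pcost_le_value N :
  (forall i, sink_vertex GP i -> forall k,
    submxcol (u k) i = - (riccati_gain (submxblock A i i) (submxblock B i i)
                          *m submxcol (z k) i)) ->
  pcost A B x0 K N <= \sum_i block_value i.
Proof.
move=> uE; rewrite pcost_blocks ler_sum // => i _.
have [si|nsi] := boolP (sink_vertex GP i); last by rewrite nonsink_bcost.
have := sink_bcost N si => /=.
rewrite big1 => [|k _]; last by rewrite uE // addNr qformv0.
rewrite addr0 => <-; rewrite lerDl.
have [pX _] := riccati_solP (submxblock A i i) (input_mx_block i inB).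
by case: (posdef_psd pX).
Qed.

Lemma block_value_le i : block_value i <=
  sqnorm (invmx (submxblock B i i) *m submxcol (A *m x0) i).
Proof.
have uB := input_mx_block i inB; rewrite /block_value; case: ifP => // _.
have [pX _] := riccati_solP (submxblock A i i) uB.
exact: lqr_next_bound uB (posdef_psd pX).
Qed.

End DeadbeatNonsinks.

(** * Upper bounds on the cost of [Gamma_Theta] *)

Section Theta.
Variables (A B : 'M[R]_n) (x0 : 'cV[R]_n).
Hypothesis stA : structured_mx GP A.
Hypothesis inB : input_mx eps B.
Let K := Gamma_Theta GP A B.

Lemma theta_input i k : submxcol (input A B K x0 k) i =
  - ((if sink_vertex GP i then
        riccati_gain (submxblock A i i) (submxblock B i i)
      else invmx (submxblock B i i))
     *m submxcol (A *m state A B K x0 k) i).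
Proof.
rewrite /input {1}/K /Gamma_Theta mulNmx -mulmxA submxcolN.
by rewrite -{1}[A *m state _ _ _ _ _]submxcolK mul_mxdiag_mxcol mxcolK.
Qed.

Lemma theta_dead i : ~~ sink_vertex GP i ->
  forall k, submxcol (state A B K x0 k.+1) i = 0.
Proof.
move=> nsi k; rewrite /= submxcolD (submxcol_input _ _ inB).
rewrite -/(input A B K x0 k) theta_input (negbTE nsi) mulmxN mulKVmx ?subrr //.
exact: input_mx_block.
Qed.

Lemma theta_cost_le_value :
  (cost A B x0 K <= (\sum_i block_value A B x0 i)%:E)%E.
Proof.
apply: cost_le => N; apply: pcost_le_value => // [|i si k].
  exact: theta_dead.
by rewrite theta_input si.
Qed.

(** A cruder bound that, B being diagonal, can be computed coordinate by coordinate on the perturbed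
    plants. *)
Lemma theta_cost_le_deadbeat :
  (cost A B x0 K <= (sqnorm (invmx B *m (A *m x0)))%:E)%E.
Proof.
apply: le_trans theta_cost_le_value _; rewrite lee_fin sqnorm_mxcol.
by apply: ler_sum => i _; rewrite submxcol_invmx // block_value_le.
Qed.

End Theta.
End BlockDynamics.

(** * A method never worse than [Gamma_Theta] is deadbeat on the non-sinks *)

Section DeadbeatNecessary.
Variables (R : realType) (q : nat) (n_ : 'I_q -> nat).
Local Notation n := (\sum_(i < q) n_ i)%N.
Variables (eps : R) (GP GK GC : digraph q) (Gamma : design_map R n_).
Hypothesis eps_gt0 : 0 < eps.
Hypothesis n_gt0 : forall i, (0 < n_ i)%N.
Hypothesis GC_loops : adjacency GC = 1%:M.
Hypothesis Gamma_method : design_methods GP eps GK GC Gamma.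
Hypothesis Gamma_le : forall (A B : 'M[R]_n) (x0 : 'cV[R]_n),
  structured_mx GP A -> input_mx eps B ->
  (cost A B x0 (Gamma A B) <= cost A B x0 (Gamma_Theta GP A B))%E.

(** The minimum over u of (a + b u)^2 + u^2 is a^2 / (1 + b^2). *)
Lemma stage_lower_bound (a b u : R) :
  a ^+ 2 <= (1 + b ^+ 2) * ((a + b * u) ^+ 2 + u ^+ 2).
Proof.
rewrite -subr_ge0.
have -> : (1 + b ^+ 2) * ((a + b * u) ^+ 2 + u ^+ 2) - a ^+ 2 =
  (a * b + (1 + b ^+ 2) * u) ^+ 2 by ring.
exact: sqr_ge0.
Qed.

(* The plant that detects a nonzero coordinate [t] after one step: block
   [sig1 p] is overwritten so that row [p] reads [r] times coordinate [t]. *)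
Section Perturbation.
Variables (A B : 'M[R]_n) (p t : 'I_n).
Implicit Types r b : R.

Definition perturb_plant r : 'M[R]_n := \matrix_(s, l)
  if tagnat.sig1 s == tagnat.sig1 p
  then (if (s == p) && (l == t) then r else 0) else A s l.

Definition perturb_input b : 'M[R]_n :=
  diag_mx (\row_s if s == p then b else B s s).

Lemma perturb_plant_structured r : structured_mx GP A ->
  GP (tagnat.sig1 t) (tagnat.sig1 p) -> structured_mx GP (perturb_plant r).
Proof.
move=> stA Gtp i j aij; apply/matrixP => k l; rewrite !mxE tagnat.Rank1K.
case: eqP => [ip|_]; last by have /matrixP/(_ k l) := stA _ _ aij; rewrite !mxE.
case: andP => // -[_ /eqP lt]; move: aij; rewrite mxE.
have -> : j = tagnat.sig1 t by rewrite -lt tagnat.Rank1K.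
by rewrite ip Gtp.
Qed.

Lemma perturb_input_diag b s :
  perturb_input b s s = if s == p then b else B s s.
Proof. by rewrite !mxE eqxx mulr1n. Qed.

Lemma perturb_input_mx b : eps <= b -> input_mx eps B ->
  input_mx eps (perturb_input b).
Proof.
move=> eb [_ eB]; split=> [|k]; first exact: diag_mx_is_diag.
by rewrite perturb_input_diag; case: ifP.
Qed.

(** The perturbation touches only the block of [p]; the block row of Gamma containing [t] sees only
    its own block, so it cannot react. *)
Lemma perturb_row r b : tagnat.sig1 t != tagnat.sig1 p ->
  structured_mx GP A -> input_mx eps B ->
  GP (tagnat.sig1 t) (tagnat.sig1 p) -> eps <= b ->
  row t (perturb_plant r) = row t A /\
  row t (Gamma (perturb_plant r) (perturb_input b)) = row t (Gamma A B).
Proof.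
move=> tp stA inB Gtp eb; split.
  by apply/rowP => l; rewrite !mxE (negbTE tp).
case: Gamma_method => _ /(_ (tagnat.sig1 t)) struct.
have := struct (perturb_plant r) (perturb_input b) A B
  (perturb_plant_structured r stA Gtp) (perturb_input_mx eb inB) stA inB.
have rowE (M : 'M[R]_n) :
    row t M = row (tagnat.sig2 t) (submxcol M (tagnat.sig1 t)).
  by apply/rowP => l; rewrite !mxE tagnat.sig2K.
rewrite !rowE => ->// j; rewrite GC_loops mxE.
case: (eqVneq (tagnat.sig1 t) j) => [<- _|_]; last by rewrite mulr0n eqxx.
split.
  by apply/matrixP => k l; rewrite !mxE tagnat.Rank1K (negbTE tp).
have [dB _] := inB; apply/matrixP => k l; rewrite !mxE.
have [->|kl] := eqVneq k l.
  rewrite eqxx mulr1n; case: eqP => // lp.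
  by move: tp; rewrite -lp tagnat.Rank1K eqxx.
pose rk := @tagnat.Rank q n_ (tagnat.sig1 t).
have rkl : rk k != rk l :> nat.
  by rewrite tagnat.eq_Rank eqxx.
rewrite -!/(rk _); have /negbTE -> : rk k != rk l.
  by apply: contraNN rkl => /eqP ->.
by rewrite mulr0n; move/is_diag_mxP: dB => ->.
Qed.

End Perturbation.

Lemma deadbeat_necessary (A B : 'M[R]_n) (x0 : 'cV[R]_n) (t : 'I_n) :
  structured_mx GP A -> input_mx eps B ->
  ~~ sink_vertex GP (tagnat.sig1 t) ->
  (A *m x0 + B *m (Gamma A B *m x0)) t 0 = 0.
Proof.
move=> stA inB /negPn/existsP[j /andP[jt Gtj]].
pose p : 'I_n := tagnat.Rank j (Ordinal (n_gt0 j)).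
have pj : tagnat.sig1 p = j by rewrite tagnat.Rank1K.
have tp : tagnat.sig1 t != tagnat.sig1 p by rewrite pj eq_sym.
rewrite -{}pj in Gtj.
set w := (_ : 'cV_n) t 0; apply/eqP; apply: contraT => w0.
(* In the perturbed plant the drift at [p] is r v at step 0 and r w at step 1. The choice of [b]
   gives b |w| > |v| and keeps the input matrix admissible. *)
pose v := x0 t 0; pose b := eps + `|v / w|.
have eb : eps <= b by rewrite lerDl.
have b0 : 0 < b by apply: lt_le_trans eb.
have vbw : v ^+ 2 < b ^+ 2 * w ^+ 2.
  rewrite -(real_normK (num_real v)) -(real_normK (num_real w)) -exprMn.
  rewrite ltr_pXn2r ?nnegrE // ?mulr_ge0 ?(ltW b0) //.
  by rewrite -ltr_pdivrMr ?normr_gt0 // -normfV -normrM ltrDr.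
(* The deadbeat price of all coordinates but [p]; it does not depend on r, since the other rows in
   the block of [p] are zeroed. *)
pose C := \sum_(s | s != p)
  ((if tagnat.sig1 s == tagnat.sig1 p then 0 else (A *m x0) s 0) / B s s) ^+ 2.
have C0 : 0 <= C by apply: sumr_ge0 => s _; exact: sqr_ge0.
have key r : r ^+ 2 * (b ^+ 2 * w ^+ 2 - v ^+ 2) <= C * (b ^+ 2 * (1 + b ^+ 2)).
  pose A' := perturb_plant A p t r; pose B' := perturb_input B p b.
  have stA' : structured_mx GP A' by exact: perturb_plant_structured.
  have inB' : input_mx eps B' by exact: perturb_input_mx.
  have [rA rG] := perturb_row r tp stA inB Gtj eb.
  have A'p y : (A' *m y) p 0 = r * y t 0.
    rewrite mxE (bigD1 t) //= mxE !eqxx /= [X in _ + X]big1 => [|l lt].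
      by rewrite addr0.
    by rewrite mxE !eqxx (negbTE lt) mul0r.
  have A's s : s != p -> (A' *m x0) s 0 =
      if tagnat.sig1 s == tagnat.sig1 p then 0 else (A *m x0) s 0.
    move=> sp; rewrite mxE; case: ifP => sp1.
      by rewrite [LHS]big1 // => l _; rewrite mxE sp1 (negbTE sp) mul0r.
    by rewrite [RHS]mxE; apply: eq_bigr => l _; rewrite mxE sp1.
  have B'v (y : 'cV_n) s :
      (B' *m y) s 0 = (if s == p then b else B s s) * y s 0.
    by rewrite diag_mul_entry ?perturb_input_diag ?diag_mx_is_diag.
  have Theta : sqnorm (invmx B' *m (A' *m x0)) = C + (r * v / b) ^+ 2.
    have uB' := input_mx_unit eps_gt0 inB'.
    have D s : (invmx B' *m (A' *m x0)) s 0 =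
        (A' *m x0) s 0 / (if s == p then b else B s s).
      rewrite -[in RHS](mulKVmx uB' (A' *m x0)) B'v mulrAC divff ?mul1r //.
      case: ifP => _; first by rewrite gt_eqF.
      by case: inB => _ eB; rewrite gt_eqF // (lt_le_trans eps_gt0).
    rewrite sqnormE (bigD1 p) //= D eqxx A'p addrC; congr (_ + _).
    by apply: eq_bigr => s sp; rewrite D (negbTE sp) A's.
  pose x k := state A' B' (Gamma A' B') x0 k.
  pose u k := input A' B' (Gamma A' B') x0 k.
  have xp k : x k.+1 p 0 = r * x k t 0 + b * u k p 0.
    by rewrite /x /= mxE A'p B'v eqxx.
  have x1t : x 1%N t 0 = w.
    have mulE (M N : 'M[R]_n) (y : 'cV[R]_n) :
        row t M = row t N -> (M *m y) t 0 = (N *m y) t 0.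
      move=> /(congr1 (mulmx^~ y)); rewrite -!row_mul => /rowP/(_ 0).
      by rewrite !mxE.
    have npt : (t == p) = false by apply: contraNF tp => /eqP ->.
    have addE (y1 y2 : 'cV[R]_n) : (y1 + y2) t 0 = y1 t 0 + y2 t 0.
      by rewrite mxE.
    rewrite /x /w /= !addE B'v npt (mulE _ _ _ rA) (mulE _ _ _ rG).
    by rewrite (@diag_mul_entry _ _ B) //; case: inB.
  (* Horizon 2 is the first at which [pcost] counts x(2). *)
  have Gam : (x 1%N p 0 ^+ 2 + u 0%N p 0 ^+ 2)
      + (x 2%N p 0 ^+ 2 + u 1%N p 0 ^+ 2) <= pcost A' B' x0 (Gamma A' B') 2.
    rewrite /pcost !big_ord_recr !big_ord0 /=.
    have := entry_le_sqnorm (x 1%N) p; have := entry_le_sqnorm (x 2%N) p.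
    have := entry_le_sqnorm (u 0%N) p; have := entry_le_sqnorm (u 1%N) p.
    have := sqnorm_ge0 (u 2%N).
    rewrite /x /u /=; lra.
  have : pcost A' B' x0 (Gamma A' B') 2 <= C + (r * v / b) ^+ 2.
    rewrite -Theta -lee_fin; apply: le_trans (pcost_le_cost _ _ _ _ _) _.
    apply: le_trans (Gamma_le _ stA' inB') _.
    exact: (theta_cost_le_deadbeat eps_gt0).
  move=> /(le_trans Gam); rewrite !xp x1t => leS.
  (* Gamma pays at least ((r v)^2 + (r w)^2) / (1 + b^2), against at most C + (r v / b)^2 for
     [Gamma_Theta]; clearing denominators yields [key]. *)
  have [S lS {}leS] : exists2 S : R,
      (r * v) ^+ 2 + (r * w) ^+ 2 <= (1 + b ^+ 2) * S &
      S <= C + (r * v / b) ^+ 2.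
    by eexists; last exact: leS; rewrite mulrDr lerD ?stage_lower_bound.
  have lbS := ler_wpM2l (sqr_ge0 b) lS.
  have ubS : (1 + b ^+ 2) * (b ^+ 2 * S) <=
      (1 + b ^+ 2) * (b ^+ 2 * C + (r * v) ^+ 2).
    have <- : b ^+ 2 * (C + (r * v / b) ^+ 2) = b ^+ 2 * C + (r * v) ^+ 2.
      by field; rewrite gt_eqF.
    by rewrite ler_wpM2l ?addr_ge0 ?sqr_ge0 // ler_wpM2l ?sqr_ge0.
  lra.
pose d := b ^+ 2 * w ^+ 2 - v ^+ 2.
have d0 : 0 < d by rewrite subr_gt0.
pose M := C * (b ^+ 2 * (1 + b ^+ 2)).
have M0 : 0 <= M.
  by rewrite /M mulr_ge0 // mulr_ge0 ?sqr_ge0 // addr_ge0 ?sqr_ge0.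
(* [key] says r^2 d <= M, which fails here because (1 + a)^2 > a for a >= 0. *)
have := key (1 + M / d); rewrite -/d -/M leNgt => /negP; case.
have Md : 0 <= M / d by rewrite divr_ge0 // ltW.
have e : M = M / d * d by rewrite divfK // gt_eqF.
rewrite {1}e ltr_pM2r //; nra.
Qed.

(** The gain does not depend on the initial state, so every step is a first step started from
    x(k). *)
Lemma design_dead (A B : 'M[R]_n) (x0 : 'cV[R]_n) (i : 'I_q) :
  structured_mx GP A -> input_mx eps B -> ~~ sink_vertex GP i ->
  forall k, submxcol (state A B (Gamma A B) x0 k.+1) i = 0.
Proof.
move=> stA inB nsi k; apply/matrixP => s l; rewrite ord1 [LHS]mxE [RHS]mxE.
by apply: deadbeat_necessary => //; rewrite tagnat.Rank1K.
Qed.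

End DeadbeatNecessary.

Theorem theorem3p24 (R : realType) (q : nat) (n_ : 'I_q -> nat) (eps : R)
    (GP GK GC : digraph q)
    (q_ge1 : (1 <= q)%N) (n_ge1 : forall i : 'I_q, (1 <= n_ i)%N)
    (eps_gt0 : 0 < eps)
    (no_isolated : forall i : 'I_q, ~~ isolated_vertex GP i)
    (has_sink : exists i : 'I_q, sink_vertex GP i)
    (GC_loops : adjacency GC = 1%:M)
    (GK_GP : supergraph GK GP) :
  ~ exists Gamma : design_map R n_,
      design_methods GP eps GK GC Gamma /\
      dominates GP eps Gamma (@Gamma_Theta R q n_ GP).
Proof.
move=> [Gamma [GammaC [Gamma_le [A [B [x0 [stA inB]]]]]]]; rewrite ltNge.
(* The sum of the block values separates the two costs at the plant where strict improvement was
   claimed. *)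
move=> /negP; apply; apply: le_trans (theta_cost_le_value eps_gt0 x0 stA inB) _.
apply: (value_le_cost eps_gt0 stA inB) => i nsi.
exact: (design_dead eps_gt0 n_ge1 GC_loops GammaC Gamma_le).
Qed.
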